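(* Let $A$ be a residuated lattice. The following are equivalent: (1) $A$ is semilocal and has the Boolean Lifting Property (BLP); (2) $A$ is semilocal and $\mathrm{Rad}(A)$ has BLP; (3) there exist an integer $n\geq 1$ and a complete set $\{e_1,\ldots ,e_n\}\subseteq \mathcal{B}(A)$ such that $[e_1),\ldots ,[e_n)$ are local residuated lattices; (4) $A$ is isomorphic to a finite direct product of local residuated lattices.
   Context: A residuated lattice is a commutative integral bounded one: a structure $(A,\vee ,\wedge ,\odot ,\rightarrow ,0,1)$ such that $(A,\vee ,\wedge ,0,1)$ is a bounded lattice, $(A,\odot ,1)$ is a commutative monoid, and $a\leq b\rightarrow c$ iff $a\odot b\leq c$ for all $a,b,c\in A$. Write $a\leftrightarrow b=(a\rightarrow b)\wedge (b\rightarrow a)$. $\mathcal{B}(A)$ is the set of complemented elements of the bounded lattice reduct of $A$. A filter of $A$ is a nonempty subset closed under $\odot$ and upward closed. A maximal filter is a maximal element, under inclusion, of the set of filters different from $A$; $\mathrm{Max}(A)$ is the set of maximal filters, and $\mathrm{Rad}(A)$ is their intersection (equal to $A$ if $A$ has only one element). $A$ is local iff it has exactly one maximal filter, and semilocal iff $\mathrm{Max}(A)$ is finite. For $e\in \mathcal{B}(A)$, $[e)=\{a\in A : e\leq a\}$ is the filter generated by $e$, and it is a residuated lattice $([e),\vee ,\wedge ,\odot ,\rightarrow _e,e,1)$ with $\vee,\wedge,\odot$ induced from $A$ and $a\rightarrow _eb=e\vee (a\rightarrow b)$. A subset $\{x_1,\ldots ,x_n\}\subseteq A$, $n\geq 1$,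 is complete iff $x_1\wedge\cdots\wedge x_n=0$ and $x_i\vee x_j=1$ for all $i\neq j$. For a filter $F$, $A/F$ is the quotient residuated lattice by the congruence $a\equiv b$ iff $a\leftrightarrow b\in F$, with classes $a/F$. $F$ has BLP iff for every $f\in \mathcal{B}(A/F)$ there is $e\in \mathcal{B}(A)$ with $e/F=f$. $A$ has BLP iff all its filters have BLP.
   Formalization: The equivalence with (3) is proved for A with 0 ≠ 1, since the one-element algebra satisfies (1) and (2) but not (3); for every A, (1), (2) and (4) are shown equivalent, with the empty product allowed in (4). *)

(* Defs.v *)
From HB Require Import structures.
From mathcomp Require Import all_boot all_order.
From mathcomp Require Import boolp classical_sets cardinality.

Set Implicit Arguments.
Unset Strict Implicit.
Unset Printing Implicit Defensive.

Import Order.TTheory.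
Local Open Scope classical_set_scope.
Local Open Scope quotient_scope.
Local Open Scope order_scope.

Fact rl_display : Order.disp_t. Proof. exact: Order.Disp tt tt. Qed.

(* "Residuated lattice" means commutative, integral and bounded; the           *)
(* one-element algebra (\bot = \top) is allowed.                               *)
HB.mixin Record TBLattice_isResiduated A of Order.TBLattice rl_display A := {
  odot : A -> A -> A;
  rimp : A -> A -> A;
  odotA : associative odot;
  odotC : commutative odot;
  odot1x : left_id (\top : A) odot;
  rimpP : forall a b c : A, (a <= rimp b c) = (odot a b <= c)
}.

#[short(type="residuatedLatticeType")]
HB.structure Definition ResiduatedLattice :=
  { A of Order.TBLattice rl_display A & TBLattice_isResiduated A }.

Notation "a ⊙ b" := (odot a b) (at level 40, left associativity) : order_scope.
Notation "a ⇒ b" := (rimp a b) (at level 55, right associativity) : order_scope.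
Notation "a ⇔ b" := ((a ⇒ b) `&` (b ⇒ a))%O (at level 55, no associativity)
  : order_scope.

Section Basics.
Context {A : residuatedLatticeType}.
Implicit Types a b c d f g : A.

Lemma odotx1 a : a ⊙ \top = a. Proof. by rewrite odotC odot1x. Qed.

Lemma odotACA a b c d : (a ⊙ b) ⊙ (c ⊙ d) = (a ⊙ c) ⊙ (b ⊙ d).
Proof. by rewrite -!odotA (odotA b) (odotC b c) -(odotA c). Qed.

Lemma rimp_mp a b : (a ⇒ b) ⊙ a <= b. Proof. by rewrite -rimpP. Qed.

Lemma odot_le2r a b c : a <= b -> a ⊙ c <= b ⊙ c.
Proof. by move=> ab; rewrite -rimpP (le_trans ab)// rimpP. Qed.

Lemma odot_le2 a b c d : a <= b -> c <= d -> a ⊙ c <= b ⊙ d.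
Proof.
by move=> ab cd; rewrite (le_trans (odot_le2r c ab))// !(odotC b) odot_le2r.
Qed.

Lemma odot_lel a b : a ⊙ b <= a.
Proof. by rewrite -{2}(odotx1 a) odot_le2// lex1. Qed.

Lemma odot_ler a b : a ⊙ b <= b. Proof. by rewrite odotC odot_lel. Qed.

Lemma odot_lejoin a b c f : f ⊙ a <= c -> f ⊙ b <= c -> f ⊙ (a `|` b) <= c.
Proof. by rewrite !(odotC f) -!rimpP leUx => -> ->. Qed.

End Basics.

Definition complemented {A : residuatedLatticeType} (a : A) : Prop :=
  exists b : A, a `&` b = \bot /\ a `|` b = \top.

Definition boolean_center (A : residuatedLatticeType) : set A :=
  [set a | complemented a].
Arguments boolean_center A : clear implicits.

Lemma complemented_odot (A : residuatedLatticeType) (e : A) :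
  boolean_center A e -> e ⊙ e = e.
Proof.
move=> [f [ef0 ef1]]; apply/le_anti; rewrite odot_lel /=.
rewrite -{1}(odotx1 e) -ef1 odot_lejoin//.
by rewrite (@le_trans _ _ \bot) ?le0x// -ef0 lexI odot_lel odot_ler.
Qed.

Record is_filter (A : residuatedLatticeType) (F : set A) : Prop := IsFilter {
  filter_neq0 : F !=set0;
  filter_odot : forall a b, F a -> F b -> F (a ⊙ b);
  filter_up : forall a b, a <= b -> F a -> F b
}.

Record rl_filter (A : residuatedLatticeType) := RLFilter {
  filter_set :> A -> Prop;
  filterP : is_filter filter_set
}.

Section Filters.
Variable A : residuatedLatticeType.

Definition maximal_filter (M : set A) : Prop :=
  [/\ is_filter M, M <> setT &
      forall G : set A, is_filter G -> G <> setT -> M `<=` G -> G = M].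

Definition max_spec : set (set A) := [set M | maximal_filter M].

(* An empty intersection is setT, which covers the one-element algebra. *)
Definition rad_set : set A := \bigcap_(M in max_spec) M.

Lemma rad_is_filter : is_filter rad_set.
Proof.
split; first by exists \top => M [[[a Fa] _ up] _ _]; apply: up Fa; exact: lex1.
  by move=> a b Ra Rb M MM; case: (MM) => -[_ FM _] _ _; apply: FM;
    [exact: Ra|exact: Rb].
by move=> a b ab Ra M MM; case: (MM) => -[_ _ up] _ _; apply: up ab (Ra _ MM).
Qed.

Definition Rad : rl_filter A := RLFilter rad_is_filter.

(* The one-element algebra has no maximal filter: it is semilocal, not local. *)
Definition is_local : Prop := exists! M : set A, maximal_filter M.

Definition is_semilocal : Prop := finite_set max_spec.

End Filters.

Section FilterEquiv.
Variables (A : residuatedLatticeType) (F : rl_filter A).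
Implicit Types a b c : A.

Definition filter_equiv : rel A := fun a b => `[< F (a ⇔ b) >].

Lemma filter1 : F \top.
Proof. by have [[a Fa] _ up] := filterP F; apply: up Fa; exact: lex1. Qed.

Lemma filterI a b : F (a `&` b) <-> F a /\ F b.
Proof.
have [_ FM up] := filterP F; split=> [Fab|[Fa Fb]].
  by split; apply: up Fab; [exact: leIl|exact: leIr].
by apply: up (FM _ _ Fa Fb); rewrite lexI odot_lel odot_ler.
Qed.

Lemma filter_rimp a b : F (a ⇒ b) <-> exists2 f, F f & f ⊙ a <= b.
Proof.
have [_ _ up] := filterP F; split=> [Fab|[f Ff]]; last first.
  by rewrite -rimpP => /up; exact.
by exists (a ⇒ b); rewrite ?rimp_mp.
Qed.

Lemma filter_rimp_le a b : a <= b -> F (a ⇒ b).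
Proof.
by move=> ab; apply/filter_rimp; exists \top; [exact: filter1|rewrite odot1x].
Qed.

Lemma filter_rimp_trans a b c : F (a ⇒ b) -> F (b ⇒ c) -> F (a ⇒ c).
Proof.
have [_ FM _] := filterP F.
move=> /filter_rimp[f Ff fab] /filter_rimp[g Fg gbc]; apply/filter_rimp.
exists (g ⊙ f); first exact: FM.
by rewrite -odotA (le_trans _ gbc)// odot_le2.
Qed.

Lemma filter_rimp_meet a b c : F (c ⇒ (a `&` b)) <-> F (c ⇒ a) /\ F (c ⇒ b).
Proof.
have [_ FM _] := filterP F; split=> [Fc|[]].
  by split; apply: filter_rimp_trans Fc _; apply: filter_rimp_le;
    [exact: leIl|exact: leIr].
move=> /filter_rimp[f Ff fca] /filter_rimp[g Fg gcb]; apply/filter_rimp.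
exists (f ⊙ g); first exact: FM.
rewrite lexI; apply/andP; split; [apply: le_trans fca|apply: le_trans gcb];
  by apply: odot_le2r; rewrite ?odot_lel ?odot_ler.
Qed.

Lemma filter_rimp_join a b c : F ((a `|` b) ⇒ c) <-> F (a ⇒ c) /\ F (b ⇒ c).
Proof.
have [_ FM _] := filterP F; split=> [Fc|[]].
  by split; apply: filter_rimp_trans Fc; apply: filter_rimp_le;
    [exact: leUl|exact: leUr].
move=> /filter_rimp[f Ff fac] /filter_rimp[g Fg gbc]; apply/filter_rimp.
exists (f ⊙ g); first exact: FM.
by apply: odot_lejoin; [apply: le_trans fac|apply: le_trans gbc];
  apply: odot_le2r; rewrite ?odot_lel ?odot_ler.
Qed.

Lemma filter_rimp_odot a b a' b' :
  F (a ⇒ a') -> F (b ⇒ b') -> F ((a ⊙ b) ⇒ (a' ⊙ b')).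
Proof.
have [_ FM _] := filterP F.
move=> /filter_rimp[f Ff faa] /filter_rimp[g Fg gbb]; apply/filter_rimp.
by exists (f ⊙ g); [exact: FM|rewrite odotACA odot_le2].
Qed.

Lemma filter_rimp_res a b c : F (a ⇒ (b ⇒ c)) <-> F ((a ⊙ b) ⇒ c).
Proof.
by split=> /filter_rimp[f Ff fabc]; apply/filter_rimp; exists f;
  move: fabc; rewrite // rimpP odotA.
Qed.

Lemma filter_rimp_rimp a b a' b' :
  F (a' ⇒ a) -> F (b ⇒ b') -> F ((a ⇒ b) ⇒ (a' ⇒ b')).
Proof.
move=> Fa Fb; apply/filter_rimp_res.
apply: filter_rimp_trans Fb; apply: (@filter_rimp_trans _ ((a ⇒ b) ⊙ a)).
  by apply: filter_rimp_odot => //; apply: filter_rimp_le.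
by apply: filter_rimp_le; exact: rimp_mp.
Qed.

Lemma filter_equivP a b : reflect (F (a ⇒ b) /\ F (b ⇒ a)) (filter_equiv a b).
Proof. by apply: (iffP (asboolP _)) => /filterI. Qed.

Lemma filter_equiv_refl : reflexive filter_equiv.
Proof. by move=> a; apply/filter_equivP; split; exact: filter_rimp_le. Qed.

Lemma filter_equiv_sym : symmetric filter_equiv.
Proof. by move=> a b; rewrite /filter_equiv meetC. Qed.

Lemma filter_equiv_trans : transitive filter_equiv.
Proof.
move=> b a c /filter_equivP[ab ba] /filter_equivP[bc cb]; apply/filter_equivP.
by split; [exact: filter_rimp_trans ab bc|exact: filter_rimp_trans cb ba].
Qed.

Canonical filter_equiv_equiv := EquivRel filter_equiv
  filter_equiv_refl filter_equiv_sym filter_equiv_trans.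

Definition filter_quot := {eq_quot filter_equiv}.

HB.instance Definition _ := Choice.on filter_quot.
HB.instance Definition _ := EqQuotient.on filter_quot.

Let fq := filter_quot.

Definition quot_meet := lift_op2 fq (fun a b => a `&` b).
Definition quot_join := lift_op2 fq (fun a b => a `|` b).
Definition quot_odot := lift_op2 fq (fun a b => a ⊙ b).
Definition quot_rimp := lift_op2 fq (fun a b => a ⇒ b).

Lemma filter_equiv_repr a : filter_equiv a (repr (\pi_fq a)).
Proof. by rewrite -eqmodE reprK. Qed.

Lemma pi_quot_meet : {morph \pi_fq : a b / a `&` b >-> quot_meet a b}.
Proof.
unlock quot_meet => a b; apply/eqmodP/filter_equivP.
have /filter_equivP[a1 a2] := filter_equiv_repr a.
have /filter_equivP[b1 b2] := filter_equiv_repr b.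
by split; apply/filter_rimp_meet; split; [apply: filter_rimp_trans a1|
  apply: filter_rimp_trans b1|apply: filter_rimp_trans a2|
  apply: filter_rimp_trans b2]; apply: filter_rimp_le; rewrite ?leIl ?leIr.
Qed.
Canonical pi_quot_meet_morph := PiMorph2 pi_quot_meet.

Lemma pi_quot_join : {morph \pi_fq : a b / a `|` b >-> quot_join a b}.
Proof.
unlock quot_join => a b; apply/eqmodP/filter_equivP.
have /filter_equivP[a1 a2] := filter_equiv_repr a.
have /filter_equivP[b1 b2] := filter_equiv_repr b.
by split; apply/filter_rimp_join; split; [apply: (filter_rimp_trans a1)|
  apply: (filter_rimp_trans b1)|apply: (filter_rimp_trans a2)|
  apply: (filter_rimp_trans b2)]; apply: filter_rimp_le; rewrite ?leUl ?leUr.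
Qed.
Canonical pi_quot_join_morph := PiMorph2 pi_quot_join.

Lemma pi_quot_odot : {morph \pi_fq : a b / a ⊙ b >-> quot_odot a b}.
Proof.
unlock quot_odot => a b; apply/eqmodP/filter_equivP.
have /filter_equivP[a1 a2] := filter_equiv_repr a.
have /filter_equivP[b1 b2] := filter_equiv_repr b.
by split; apply: filter_rimp_odot.
Qed.
Canonical pi_quot_odot_morph := PiMorph2 pi_quot_odot.

Lemma pi_quot_rimp : {morph \pi_fq : a b / a ⇒ b >-> quot_rimp a b}.
Proof.
unlock quot_rimp => a b; apply/eqmodP/filter_equivP.
have /filter_equivP[a1 a2] := filter_equiv_repr a.
have /filter_equivP[b1 b2] := filter_equiv_repr b.
by split; apply: filter_rimp_rimp.
Qed.
Canonical pi_quot_rimp_morph := PiMorph2 pi_quot_rimp.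

Definition quot_le : rel fq := fun x y => quot_meet x y == x.

Lemma pi_quot_le a b : quot_le (\pi_fq a) (\pi_fq b) = `[< F (a ⇒ b) >].
Proof.
rewrite /quot_le piE; apply/filter_equivP/asboolP => [[_ Fab]|Fab].
  by have /filter_rimp_meet[] := Fab.
split; first by apply: filter_rimp_le; rewrite leIl.
by apply/filter_rimp_meet; split=> //; exact: filter_rimp_le.
Qed.

Fact quot_le_refl : reflexive quot_le.
Proof.
by move=> x; elim/quotW: x => a; rewrite pi_quot_le; apply/asboolP/filter_rimp_le.
Qed.

Fact quot_le_anti : antisymmetric quot_le.
Proof.
move=> x y; elim/quotW: x => a; elim/quotW: y => b.
rewrite !pi_quot_le => /andP[/asboolP ab /asboolP ba].
by apply/eqmodP/filter_equivP.
Qed.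

Fact quot_le_trans : transitive quot_le.
Proof.
move=> y x z; elim/quotW: x => a; elim/quotW: y => b; elim/quotW: z => c.
rewrite !pi_quot_le => /asboolP ab /asboolP bc.
by apply/asboolP; exact: filter_rimp_trans ab bc.
Qed.

HB.instance Definition _ := Order.Le_isPOrder.Build rl_display filter_quot
  quot_le_refl quot_le_anti quot_le_trans.

Fact quot_meetP (x y z : fq) : (x <= quot_meet y z) = (x <= y) && (x <= z).
Proof.
elim/quotW: x => a; elim/quotW: y => b; elim/quotW: z => c.
rewrite /Order.le /= -pi_quot_meet !pi_quot_le.
by apply/asboolP/andP => [/filter_rimp_meet[] ? ?|[/asboolP ? /asboolP ?]];
  [split; exact/asboolP|exact/filter_rimp_meet].
Qed.

Fact quot_joinP (x y z : fq) : (quot_join x y <= z) = (x <= z) && (y <= z).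
Proof.
elim/quotW: x => a; elim/quotW: y => b; elim/quotW: z => c.
rewrite /Order.le /= -pi_quot_join !pi_quot_le.
by apply/asboolP/andP => [/filter_rimp_join[] ? ?|[/asboolP ? /asboolP ?]];
  [split; exact/asboolP|exact/filter_rimp_join].
Qed.

HB.instance Definition _ := Order.POrder_MeetJoin_isLattice.Build rl_display
  filter_quot quot_meetP quot_joinP.

Fact quot_le0x (x : fq) : \pi_fq \bot <= x.
Proof.
elim/quotW: x => a; rewrite /Order.le /= pi_quot_le.
by apply/asboolP/filter_rimp_le; rewrite le0x.
Qed.

Fact quot_lex1 (x : fq) : x <= \pi_fq \top.
Proof.
elim/quotW: x => a; rewrite /Order.le /= pi_quot_le.
by apply/asboolP/filter_rimp_le; rewrite lex1.
Qed.

HB.instance Definition _ :=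
  Order.hasBottom.Build rl_display filter_quot quot_le0x.
HB.instance Definition _ :=
  Order.hasTop.Build rl_display filter_quot quot_lex1.

Fact quot_odotA : associative quot_odot.
Proof.
move=> x y z; elim/quotW: x => a; elim/quotW: y => b; elim/quotW: z => c.
by rewrite !piE odotA.
Qed.

Fact quot_odotC : commutative quot_odot.
Proof.
by move=> x y; elim/quotW: x => a; elim/quotW: y => b; rewrite !piE odotC.
Qed.

Fact quot_odot1x : left_id (\top : fq) quot_odot.
Proof.
by move=> x; elim/quotW: x => a; rewrite /Order.top /= -pi_quot_odot odot1x.
Qed.

Fact quot_rimpP (x y z : fq) : (x <= quot_rimp y z) = (quot_odot x y <= z).
Proof.
elim/quotW: x => a; elim/quotW: y => b; elim/quotW: z => c.
rewrite /Order.le /= -pi_quot_rimp -pi_quot_odot !pi_quot_le.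
by apply/asboolP/asboolP => /filter_rimp_res.
Qed.

HB.instance Definition _ := TBLattice_isResiduated.Build filter_quot
  quot_odotA quot_odotC quot_odot1x quot_rimpP.

End FilterEquiv.

Definition filter_BLP (A : residuatedLatticeType) (F : rl_filter A) : Prop :=
  forall f : filter_quot F, boolean_center (filter_quot F) f ->
    exists2 e : A, boolean_center A e & \pi_(filter_quot F) e = f.

Definition has_BLP (A : residuatedLatticeType) : Prop :=
  forall F : rl_filter A, filter_BLP F.

Section Upset.
Variables (A : residuatedLatticeType) (e : A) (eB : boolean_center A e).

Definition above : pred A := fun a => e <= a.

(* The proof h is a parameter of the type because [e) is closed under odot
   only when e is idempotent. *)
Record upset (h : boolean_center A e) := Upset {
  upset_val : A;
  upset_valP : above upset_val
}.

Local Notation U := (upset eB).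

HB.instance Definition _ := [isSub for @upset_val eB].
HB.instance Definition _ := [Choice of U by <:].

Fact above_meet : meet_closed above.
Proof. by move=> a b; rewrite !unfold_in /above lexI => -> ->. Qed.

Fact above_join : join_closed above.
Proof. by move=> a b; rewrite !unfold_in /above => ea _; exact: lexUl. Qed.

HB.instance Definition _ := Order.SubChoice_isSubLattice.Build
  rl_display A above rl_display U above_meet above_join.

Definition upset_bot : U := Upset eB (lexx e).
Definition upset_top : U := @Upset eB \top (lex1 e).

Fact upset_le0x (x : U) : upset_bot <= x.
Proof. by rewrite -Order.le_val; exact: upset_valP. Qed.

Fact upset_lex1 (x : U) : x <= upset_top.
Proof. by rewrite -Order.le_val lex1. Qed.

HB.instance Definition _ := Order.hasBottom.Build rl_display U upset_le0x.
HB.instance Definition _ := Order.hasTop.Build rl_display U upset_lex1.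

Fact above_odot (x y : U) : above (val x ⊙ val y).
Proof.
have : e ⊙ e <= val x ⊙ val y by apply: odot_le2; exact: upset_valP.
by rewrite (complemented_odot eB).
Qed.

Fact above_rimp (x y : U) : above (e `|` (val x ⇒ val y)).
Proof. exact: leUl. Qed.

Definition upset_odot (x y : U) : U := Upset eB (above_odot x y).
Definition upset_rimp (x y : U) : U := Upset eB (above_rimp x y).

Fact upset_odotA : associative upset_odot.
Proof. by move=> x y z; apply: val_inj; exact: odotA. Qed.

Fact upset_odotC : commutative upset_odot.
Proof. by move=> x y; apply: val_inj; exact: odotC. Qed.

Fact upset_odot1x : left_id (\top : U) upset_odot.
Proof. by move=> x; apply: val_inj; exact: odot1x. Qed.

Fact upset_rimpP (x y z : U) : (x <= upset_rimp y z) = (upset_odot x y <= z).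
Proof.
rewrite -!Order.le_val /= -rimpP.
suff /join_idPr -> : e <= val y ⇒ val z by [].
by rewrite rimpP (le_trans (odot_lel _ _))//; exact: upset_valP.
Qed.

HB.instance Definition _ := TBLattice_isResiduated.Build U
  upset_odotA upset_odotC upset_odot1x upset_rimpP.

End Upset.

Definition complete_family (A : residuatedLatticeType) (n : nat)
    (x : 'I_n -> A) : Prop :=
  [/\ (1 <= n)%N, \meet_(i < n) x i = \bot &
      forall i j, i != j -> x i `|` x j = \top].

Section Product.
Variables (n : nat) (B : 'I_n -> residuatedLatticeType).

Definition rl_prod := {dffun forall i : 'I_n, B i}.

HB.instance Definition _ := Choice.on rl_prod.

Implicit Types x y z : rl_prod.

Definition prod_le : rel rl_prod := fun x y => [forall i, x i <= y i].
Definition prod_meet x y : rl_prod := [ffun i => x i `&` y i].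
Definition prod_join x y : rl_prod := [ffun i => x i `|` y i].
Definition prod_bot : rl_prod := [ffun i => \bot].
Definition prod_top : rl_prod := [ffun i => \top].
Definition prod_odot x y : rl_prod := [ffun i => x i ⊙ y i].
Definition prod_rimp x y : rl_prod := [ffun i => x i ⇒ y i].

Fact prod_le_refl : reflexive prod_le.
Proof. by move=> x; apply/forallP. Qed.

Fact prod_le_anti : antisymmetric prod_le.
Proof.
move=> x y /andP[/forallP xy /forallP yx]; apply/ffunP => i.
by apply/le_anti; rewrite xy yx.
Qed.

Fact prod_le_trans : transitive prod_le.
Proof.
move=> y x z /forallP xy /forallP yz; apply/forallP => i.
exact: le_trans (xy i) (yz i).
Qed.

HB.instance Definition _ := Order.Le_isPOrder.Build rl_display rl_prod
  prod_le_refl prod_le_anti prod_le_trans.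

Lemma prod_leP x y : reflect (forall i, x i <= y i) (x <= y).
Proof. exact: forallP. Qed.

Fact prod_meetP x y z : (x <= prod_meet y z) = (x <= y) && (x <= z).
Proof.
apply/prod_leP/andP => [xyz|[/prod_leP xy /prod_leP xz] i].
  by split; apply/prod_leP => i; have := xyz i; rewrite ffunE lexI => /andP[].
by rewrite ffunE lexI xy xz.
Qed.

Fact prod_joinP x y z : (prod_join x y <= z) = (x <= z) && (y <= z).
Proof.
apply/prod_leP/andP => [xyz|[/prod_leP xz /prod_leP yz] i].
  by split; apply/prod_leP => i; have := xyz i; rewrite ffunE leUx => /andP[].
by rewrite ffunE leUx xz yz.
Qed.

HB.instance Definition _ := Order.POrder_MeetJoin_isLattice.Build rl_display
  rl_prod prod_meetP prod_joinP.

Fact prod_le0x x : prod_bot <= x.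
Proof. by apply/prod_leP => i; rewrite ffunE le0x. Qed.

Fact prod_lex1 x : x <= prod_top.
Proof. by apply/prod_leP => i; rewrite ffunE lex1. Qed.

HB.instance Definition _ := Order.hasBottom.Build rl_display rl_prod prod_le0x.
HB.instance Definition _ := Order.hasTop.Build rl_display rl_prod prod_lex1.

Fact prod_odotA : associative prod_odot.
Proof. by move=> x y z; apply/ffunP => i; rewrite !ffunE odotA. Qed.

Fact prod_odotC : commutative prod_odot.
Proof. by move=> x y; apply/ffunP => i; rewrite !ffunE odotC. Qed.

Fact prod_odot1x : left_id (\top : rl_prod) prod_odot.
Proof. by move=> x; apply/ffunP => i; rewrite !ffunE odot1x. Qed.

Fact prod_rimpP x y z : (x <= prod_rimp y z) = (prod_odot x y <= z).
Proof.
by apply/prod_leP/prod_leP => xyz i; have := xyz i; rewrite !ffunE rimpP.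
Qed.

HB.instance Definition _ := TBLattice_isResiduated.Build rl_prod
  prod_odotA prod_odotC prod_odot1x prod_rimpP.

End Product.

Record rl_morphism (A B : residuatedLatticeType) (h : A -> B) : Prop := {
  rl_morphI : {morph h : a b / a `&` b};
  rl_morphU : {morph h : a b / a `|` b};
  rl_morphM : {morph h : a b / a ⊙ b};
  rl_morph_rimp : {morph h : a b / a ⇒ b};
  rl_morph0 : h \bot = \bot;
  rl_morph1 : h \top = \top
}.

Definition rl_isomorphic (A B : residuatedLatticeType) : Prop :=
  exists2 h : A -> B, rl_morphism h & bijective h.

(* Main.v *)
Require Import Defs.
From HB Require Import structures.
From mathcomp Require Import all_boot all_order.
From mathcomp Require Import boolp classical_sets cardinality.

(** Let [A] be semilocal with maximal filters [M_1, ..., M_n]. Distinct maximal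
    filters are comaximal, so there are [x] in [M_i] and [y] in all the other
    [M_j] with [x y = 0]; modulo [Rad A], [y] is complemented by [x]. If [Rad A]
    has BLP, [y] lifts to a complemented [e_i], which lies in [M_j] exactly when
    [j <> i] ([separating_complemented]). A complemented element is idempotent,
    so it is zero as soon as it lies in no maximal filter
    ([complemented_notin_maximal]); this makes [{e_1, ..., e_n}] complete. The
    projection [a |-> a \/ e_i] pulls proper filters of [[e_i)] back to proper
    filters containing the complement of [e_i], and [M_i] is the only maximal
    filter containing that complement; hence [[e_i)] is local
    ([upset_local]).

    For a complete set of complemented elements, [a |-> (a \/ e_i)_i] is an
    isomorphism of [A] onto the product of the [[e_i)]
    ([complete_family_product]).

    Finally, let [A] be a product of local algebras [B_i]. A filter of [A] is the
    product of its images in the [B_i] ([filter_coord]). So a maximal filter has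
    a proper image in some [B_i], and is the preimage of the maximal filter of
    [B_i]: [A] is semilocal. If [a] is complemented modulo a filter [F], then,
    each [B_i] being local, its coordinates are all [0] or [1] modulo the image
    of [F] ([local_complements_mod]), and the corresponding 0-1 vector is a
    complemented lift of [a].

    The one-element algebra has no maximal filter; it is the empty product of
    local algebras, and corresponds to the empty family of [e_i]. *)

Import Order.TTheory.

Local Open Scope classical_set_scope.
Local Open Scope order_scope.

(** * Arithmetic of residuated lattices *)

Section Arithmetic.
Context {A : residuatedLatticeType}.
Implicit Types a b c x y z t : A.

(** The [k]-th power of [a] for the monoid operation. *)
Definition odot_exp a (k : nat) : A := iter k (odot a) \top.

Lemma odot_joinl a b c : (a `|` b) ⊙ c = a ⊙ c `|` b ⊙ c.
Proof.
apply/le_anti; rewrite -{1}rimpP !leUx !rimpP leUl leUr /=.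
by rewrite !odot_le2r ?leUl ?leUr.
Qed.

Lemma odot_joinr a b c : c ⊙ (a `|` b) = c ⊙ a `|` c ⊙ b.
Proof. by rewrite odotC odot_joinl !(odotC _ c). Qed.

Lemma odotx0 a : a ⊙ \bot = \bot.
Proof. by apply/le_anti; rewrite le0x odot_ler. Qed.

Lemma odot_join_le x y z : (x `|` z) ⊙ (y `|` z) <= x ⊙ y `|` z.
Proof.
rewrite odot_joinl !odot_joinr !leUx leUl /=.
by rewrite !lexUr // ?odot_lel ?odot_ler.
Qed.

(** The inequality behind primality of maximal filters: if a power of [x]
    vanishes, then a power of [x \/ y] is below [y]. *)
Lemma odot_exp_join_le x y k : odot_exp (x `|` y) k <= odot_exp x k `|` y.
Proof.
elim: k => [|k IHk] /=; first exact: leUl.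
by apply: le_trans (odot_join_le _ _ _); exact: odot_le2.
Qed.

Lemma odot_expD x k l : odot_exp x (k + l) = odot_exp x k ⊙ odot_exp x l.
Proof. by elim: k => [|k IHk]; rewrite /= ?odot1x // IHk odotA. Qed.

(** The elements whose join with [x] is [1] are closed under meets, since
    [(x \/ y) (x \/ z) <= x \/ y z]; no distributivity is needed. *)
Lemma join_meet_top x y z :
  x `|` y = \top -> x `|` z = \top -> x `|` (y `&` z) = \top.
Proof.
move=> xy xz; apply/le_anti; rewrite lex1 /=.
rewrite -(odot1x \top) -{1}xy -xz ![x `|` _]joinC.
apply: le_trans (odot_join_le _ _ _) _.
by apply: leU2 => //; rewrite lexI odot_lel odot_ler.
Qed.

Lemma join_meets_top (I : finType) x (e : I -> A) :
  (forall i, x `|` e i = \top) -> x `|` \meet_i e i = \top.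
Proof.
move=> xe; apply: (big_ind (fun z => x `|` z = \top)) => //.
  exact: joinx1.
by move=> y z; exact: join_meet_top.
Qed.

(** [a] and [b] are complements of each other in the lattice reduct. *)
Definition complements a b : Prop := a `&` b = \bot /\ a `|` b = \top.

Lemma complements_sym a b : complements a b -> complements b a.
Proof. by case=> ? ?; split; rewrite 1?meetC 1?joinC. Qed.

Lemma complements_odot a b : complements a b -> a ⊙ b = \bot.
Proof.
by case=> ab _; apply/le_anti; rewrite le0x -ab lexI odot_lel odot_ler.
Qed.

Lemma complements_bot a : complements \bot a -> a = \top.
Proof. by case=> _; rewrite join0x. Qed.

Lemma complemented_meet_odot {a} b :
  complemented a -> a `&` b = a ⊙ b.
Proof.
case=> c ac; apply/le_anti; apply/andP; split; last first.
  by rewrite lexI odot_lel odot_ler.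
rewrite -(odotx1 (a `&` b)) -ac.2; apply: odot_lejoin.
  by rewrite odotC; apply: odot_le2 => //; exact: leIr.
rewrite (le_trans _ (le0x _)) // -(complements_odot _ _ ac).
by apply: odot_le2 => //; exact: leIl.
Qed.

Lemma complements_meet a a' b b' : complements a a' -> complements b b' ->
  complements (a `&` b) (a' `|` b').
Proof.
move=> aa bb; split.
  rewrite -meetA (complemented_meet_odot _ (ex_intro _ _ aa)).
  rewrite (complemented_meet_odot _ (ex_intro _ _ bb)) odotA.
  rewrite odot_joinr -(odotA a b b') (complements_odot _ _ bb).
  rewrite (odotC a b) -(odotA b a a') (complements_odot _ _ aa).
  by rewrite !odotx0 joinxx.
rewrite joinC; apply: join_meet_top.
  by rewrite joinAC joinC (joinC a') aa.2 joinx1.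
by rewrite -joinA (joinC b') bb.2 joinx1.
Qed.

Lemma complemented_meet a b :
  complemented a -> complemented b -> complemented (a `&` b).
Proof. by move=> [a' aa] [b' bb]; exists (a' `|` b'); exact: complements_meet. Qed.

Lemma complemented_top : complemented (\top : A).
Proof. by exists \bot; rewrite meet1x join1x. Qed.

Lemma complemented_meets (I : finType) (e : I -> A) :
  (forall i, complemented (e i)) -> complemented (\meet_i e i).
Proof.
move=> eB; apply: big_ind => //; first exact: complemented_top.
exact: complemented_meet.
Qed.

End Arithmetic.

(** * Maximal filters *)

Section MaximalFilters.
Variable A : residuatedLatticeType.
Implicit Types (F G M N : set A) (a b x y m : A).

Lemma is_filter_top F : is_filter F -> F \top.
Proof. by case=> -[a Fa] _ up; apply: up Fa; exact: lex1. Qed.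

Lemma is_filter_exp F x k : is_filter F -> F x -> F (odot_exp x k).
Proof.
move=> fF Fx; elim: k => [|k IHk] /=; first exact: is_filter_top.
exact: filter_odot.
Qed.

Lemma is_filter_bot F a : is_filter F -> F \bot -> F a.
Proof. by move=> fF; apply: (filter_up fF); exact: le0x. Qed.

Lemma filter_properP F : is_filter F -> F <> setT <-> ~ F \bot.
Proof.
move=> fF; split=> [FT F0|F0 FT]; last by apply: F0; rewrite FT.
by apply: FT; apply/seteqP; split=> // a _; exact: is_filter_bot.
Qed.

Lemma maximal_filter_bot M : maximal_filter M -> ~ M \bot.
Proof. by case=> fM /(filter_properP _ fM). Qed.

(** By Zorn's lemma, applied to the sets [X] such that [F] together with [X] is a
    proper filter; in this form the empty chain needs no special treatment. *)
Lemma proper_filter_sub_maximal F : is_filter F -> ~ F \bot ->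
  exists2 M, maximal_filter M & F `<=` M.
Proof.
move=> fF F0.
have [|G [[fG G0] maxG]] :=
  @Zorn_bigcup A (fun X : set A => is_filter (F `|` X)%classic /\ ~ (F `|` X)%classic \bot).
  move=> C CP Ctot; split; last first.
    by case=> // -[X CX X0]; case: (CP _ CX) => _; apply; right.
  split.
  - by exists \top; left; exact: is_filter_top.
  - move=> a b [Fa|[X CX Xa]] [Fb|[Y CY Yb]].
    + by left; exact: filter_odot.
    + have [||?|?] := filter_odot (CP _ CY).1 (a := a) (b := b);
        [by left|by right|by left|by right; exists Y].
    + have [||?|?] := filter_odot (CP _ CX).1 (a := a) (b := b);
        [by right|by left|by left|by right; exists X].
    + have [XY|YX] := Ctot _ _ CX CY.
        have [||?|?] := filter_odot (CP _ CY).1 (a := a) (b := b);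
          [by right; exact: XY|by right|by left|by right; exists Y].
      have [||?|?] := filter_odot (CP _ CX).1 (a := a) (b := b);
        [by right|by right; exact: YX|by left|by right; exists X].
  - move=> a b ab [Fa|[X CX Xa]]; first by left; exact: (filter_up fF) Fa.
    by have [|?|?] := filter_up (CP _ CX).1 ab; [right|left|right; exists X].
exists (F `|` G)%classic; last by move=> a; left.
split=> //; first exact/filter_properP.
move=> H fH /(filter_properP _ fH) H0 sub; apply/seteqP; split=> // a Ha.
apply: contrapT => FGa; apply: (maxG H).
  by split=> [b Gb|HG]; [apply: sub; right|apply: FGa; right; exact: HG].
suff -> : (F `|` H)%classic = H by [].
by apply/seteqP; split=> [b [Fb|//]|b]; [apply: sub; left|right].
Qed.

(** An element outside a maximal filter [M] generates, together with [M], the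
    whole algebra. *)
Lemma maximal_filter_notin M x : maximal_filter M -> ~ M x ->
  exists2 m, M m & exists k, m ⊙ odot_exp x k = \bot.
Proof.
move=> maxM Mx; have [fM _ maxMG] := maxM.
pose G := [set a | exists2 m, M m & exists k, m ⊙ odot_exp x k <= a].
have fG : is_filter G.
  split.
  - by exists \top, \top; [exact: is_filter_top|exists 0; exact: lex1].
  - move=> a b [m Mm [k mk]] [p Mp [l pl]].
    exists (m ⊙ p); first exact: filter_odot.
    by exists (k + l); rewrite odot_expD odotACA odot_le2.
  - move=> a b ab [m Mm [k mk]]; exists m => //.
    by exists k; exact: le_trans ab.
have Gx : G x.
  by exists \top; [exact: is_filter_top|exists 1; rewrite odot1x /= odotx1].
have MG : M `<=` G.
  by move=> m Mm; exists m => //; exists 0; rewrite odotx1.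
have [[m Mm [k]]|G0] := pselect (G \bot).
  by rewrite lex0 => /eqP mk; exists m => //; exists k.
by case: Mx; rewrite -(maxMG _ fG _ MG) //; exact/filter_properP.
Qed.

Lemma maximal_filter_prime M x y :
  maximal_filter M -> M (x `|` y) -> M x \/ M y.
Proof.
move=> maxM Mxy; have [fM _ _] := maxM.
have [?|Mx] := pselect (M x); [by left|right].
have [m Mm [k mk]] := maximal_filter_notin _ _ maxM Mx.
apply: (filter_up fM _ (filter_odot fM Mm (is_filter_exp _ _ k fM Mxy))).
apply: le_trans (odot_le2 (lexx m) (odot_exp_join_le x y k)) _.
by rewrite odot_joinr mk join0x odot_ler.
Qed.

Lemma maximal_filter_complements M a b :
  maximal_filter M -> complements a b -> M a <-> ~ M b.
Proof.
move=> maxM ab; have [fM _ _] := maxM; split=> [Ma Mb|Mb].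
  apply: (maximal_filter_bot _ maxM); rewrite -(complements_odot _ _ ab).
  exact: filter_odot.
have [] := maximal_filter_prime _ a b maxM => //.
by rewrite ab.2; exact: is_filter_top.
Qed.

Lemma maximal_filter_eq M N :
  maximal_filter M -> maximal_filter N -> M `<=` N -> N = M.
Proof. by move=> [_ _ maxM] [fN N0 _]; exact: maxM. Qed.

(** A complemented element is idempotent, hence generates a proper filter
    unless it is zero. *)
Lemma complemented_notin_maximal w : complemented w ->
  (forall M, maximal_filter M -> ~ M w) -> w = \bot.
Proof.
move=> wB wM; apply: contrapT => w0.
have [|w0'|M maxM wM'] := proper_filter_sub_maximal [set a | w <= a].
- split; first by exists w => /=.
    by move=> a b /= wa wb; rewrite -(complemented_odot wB) odot_le2.
  by move=> a b ab /= wa; exact: le_trans ab.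
- by apply: w0; apply/le_anti; rewrite le0x andbT; exact: w0'.
- by apply: (wM M maxM); apply: wM'; exact: lexx.
Qed.

(** Distinct maximal filters are comaximal. *)
Lemma maximal_filters_comaximal M N :
  maximal_filter M -> maximal_filter N -> M <> N ->
  exists2 x, M x & exists2 y, N y & x ⊙ y = \bot.
Proof.
move=> maxM maxN MN; have [fN _ _] := maxN.
have [y Ny My] : exists2 y, N y & ~ M y.
  apply: contrapT => NM; apply: MN; apply: maximal_filter_eq => // y Ny.
  by apply: contrapT => My; apply: NM; exists y.
have [x Mx [k xk]] := maximal_filter_notin _ _ maxM My.
by exists x => //; exists (odot_exp y k) => //; exact: is_filter_exp.
Qed.

(** Comaximality with each of finitely many filters gives comaximality with
    their intersection. *)
Lemma comaximal_bigcap M (s : seq (set A)) : is_filter M ->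
  (forall N, N \in s -> is_filter N) ->
  (forall N, N \in s -> exists2 x, M x & exists2 y, N y & x ⊙ y = \bot) ->
  exists2 x, M x & exists2 y, (forall N, N \in s -> N y) & x ⊙ y = \bot.
Proof.
move=> fM; elim: s => [|N s IHs] fs co.
  by exists \top; [exact: is_filter_top|exists \bot; rewrite ?odotx0].
have [|?|x Mx [y sy xy]] := IHs.
- by move=> N' N's; apply: fs; rewrite in_cons N's orbT.
- by move=> N's; apply: co; rewrite in_cons N's orbT.
have [x' Mx' [y' Ny' xy']] := co N (mem_head _ _).
exists (x ⊙ x'); first exact: filter_odot.
exists (y `|` y').
  move=> N'; rewrite in_cons => /orP[/eqP ->|N's].
    by apply: (filter_up (fs _ (mem_head _ _))) Ny'; exact: leUr.
  apply: (filter_up (fs N' _)) (sy _ N's); last exact: leUl.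
  by rewrite in_cons N's orbT.
rewrite odot_joinr {1}(odotC x) -!odotA xy xy' !odotx0.
by rewrite joinxx.
Qed.

(** An algebra is local as soon as its proper filters have a greatest one. *)
Lemma greatest_filter_local M : is_filter M -> ~ M \bot ->
  (forall G, is_filter G -> ~ G \bot -> G `<=` M) -> is_local A.
Proof.
move=> fM M0 gM; have maxM : maximal_filter M.
  split=> //; first exact/filter_properP.
  move=> G fG /(filter_properP _ fG) G0 MG.
  by apply/seteqP; split=> //; exact: gM.
exists M; split=> // N maxN; have [fN _ _] := maxN.
by apply: maximal_filter_eq => //; apply: gM => //; exact: maximal_filter_bot.
Qed.

Lemma local_maximal_rad M : is_local A -> maximal_filter M -> M = rad_set (A := A).
Proof.
move=> [N [maxN uniN]] maxM; apply/seteqP; split=> [a Ma K maxK|a]; last exact.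
by rewrite -(uniN K maxK) (uniN M maxM).
Qed.

(** Quotients of a local algebra have a trivial Boolean center: if [x] and [y]
    are complementary modulo [G], then one of them belongs to [G]. *)
Lemma local_complements_mod G x y : is_local A -> is_filter G ->
  G (x `|` y) -> G ((x `&` y) ⇒ \bot) -> G x \/ G y.
Proof.
move=> [M [maxM uniM]] fG Gj Gm; have [fM _ _] := maxM.
(* Outside the unique maximal filter [M], every element is nilpotent. *)
have nilp z : ~ M z -> exists k, odot_exp z k = \bot.
  move=> Mz; apply: contrapT => nz.
  pose H := [set a | exists k, odot_exp z k <= a].
  have [|[k]|N maxN HN] := proper_filter_sub_maximal H.
  - split.
    + by exists \top, 0; exact: lex1.
    + move=> a b [k za] [l zb]; exists (k + l).
      by rewrite odot_expD odot_le2.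
    + by move=> a b ab [k za]; exists k; exact: le_trans ab.
  - by rewrite lex0 => /eqP zk; apply: nz; exists k.
  - apply: Mz; rewrite (uniM N maxN); apply: HN.
    by exists 1; rewrite /= odotx1.
have cancel u v : G (u `|` v) -> ~ M u -> G v.
  move=> Guv /nilp[k uk].
  apply: (filter_up fG _ (is_filter_exp _ _ k fG Guv)).
  by apply: le_trans (odot_exp_join_le _ _ _) _; rewrite uk join0x.
have [G0|G0] := pselect (G \bot); first by left; exact: is_filter_bot.
have GM : G `<=` M.
  by have [N maxN GN] := proper_filter_sub_maximal _ fG G0; rewrite (uniM N).
have [Mx|Mx] := pselect (M x); last by right; exact: cancel Gj Mx.
left; apply: (cancel y); first by rewrite joinC.
move=> My; apply: (maximal_filter_bot _ maxM).
apply: (filter_up fM (rimp_mp (x `&` y) \bot)).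
apply: filter_odot => //; first exact: GM.
apply: (filter_up fM) (filter_odot fM Mx My).
by rewrite lexI odot_lel odot_ler.
Qed.

End MaximalFilters.

(** * Homomorphisms and filters *)

Section Morphisms.
Context {A B : residuatedLatticeType}.
Variables (h : A -> B) (hM : rl_morphism h).

Lemma rl_morph_le a b : a <= b -> h a <= h b.
Proof.
by move=> /meet_idPl ab; apply/meet_idPl; rewrite -(rl_morphI hM) ab.
Qed.

Lemma rl_morph_le_inj : injective h -> forall a b, h a <= h b -> a <= b.
Proof.
by move=> hI a b /meet_idPl; rewrite -(rl_morphI hM) => /hI ab; apply/meet_idPl.
Qed.

Lemma preimage_is_filter (G : set B) : is_filter G -> is_filter (h @^-1` G).
Proof.
move=> fG; split.
- by exists \top; rewrite /= (rl_morph1 hM); exact: is_filter_top.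
- by move=> a b Ga Gb; rewrite /= (rl_morphM hM); exact: filter_odot.
- by move=> a b /rl_morph_le ab Ga; exact: (filter_up fG ab).
Qed.

Lemma image_is_filter (F : set A) :
  (forall y, exists a, h a = y) -> is_filter F -> is_filter (h @` F).
Proof.
move=> hS fF; split.
- by exists (h \top), \top => //; exact: is_filter_top.
- move=> _ _ [a Fa <-] [b Fb <-]; exists (a ⊙ b); first exact: filter_odot.
  exact: rl_morphM.
- move=> x y xy [a Fa ax]; have [b bE] := hS y.
  exists (a `|` b); first by apply: (filter_up fF) Fa; exact: leUl.
  by rewrite (rl_morphU hM) bE ax; apply/join_idPr.
Qed.

End Morphisms.

Section UpsetProjection.
Context {A : residuatedLatticeType} {e : A}.
Variable eB : boolean_center A e.

(** The projection [a |-> a \/ e] of [A] onto [[e)]. *)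
Definition upset_proj (a : A) : upset eB := Upset eB (leUr e a).

Lemma upset_proj_val (u : upset eB) : upset_proj (val u) = u.
Proof. by apply: val_inj; apply/join_idPl; exact: upset_valP. Qed.

Lemma upset_proj_morphism : rl_morphism upset_proj.
Proof.
have [f ef] := eB; have ef0 : e ⊙ f = \bot by exact: complements_odot.
split.
- move=> a b; apply: val_inj => /=; apply/le_anti.
  rewrite lexI !leU2 ?leIl ?leIr //=.
  set t := (X in X <= _).
  rewrite -(odotx1 t) -ef.2; apply: odot_lejoin.
    by apply: lexUr; exact: odot_ler.
  have tf c : (c `|` e) ⊙ f <= c.
    by rewrite odot_joinl ef0 joinx0 odot_lel.
  by rewrite lexUl // lexI; apply/andP; split;
    [apply: le_trans (tf a)|apply: le_trans (tf b)];
    apply: odot_le2r; rewrite ?leIl ?leIr.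
- by move=> a b; apply: val_inj; rewrite /= joinACA joinxx.
- move=> a b; apply: val_inj; apply/le_anti.
  rewrite /= odot_join_le andbT leUx odot_le2 ?leUl //=.
  by rewrite -{1}(complemented_odot eB) odot_le2 ?leUr.
- move=> a b; apply: val_inj; apply/le_anti/andP => /=; split.
    rewrite joinC leU2 // rimpP odot_joinr leUx.
    by rewrite lexUl ?rimp_mp // lexUr ?odot_ler.
  rewrite leUx leUr /=; set t := (X in X <= _).
  rewrite -(odotx1 t) -ef.2; apply: odot_lejoin.
    by apply: lexUr; exact: odot_ler.
  apply: lexUl; rewrite rimpP odotC odotA.
  have tb : t ⊙ a <= b `|` e.
    apply: le_trans (rimp_mp (a `|` e) _).
    by apply: odot_le2 => //; exact: leUl.
  rewrite (odotC a) (le_trans (odot_le2r f tb)) //.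
  by rewrite odot_joinl ef0 joinx0 odot_lel.
- by apply: val_inj; rewrite /= join0x.
- by apply: val_inj; rewrite /= join1x.
Qed.

End UpsetProjection.

(** * Complements modulo a filter *)

Section QuotientComplements.
Context {A : residuatedLatticeType} (F : rl_filter A).
Implicit Types a b : A.

Lemma pi_eqP a b :
  \pi_(filter_quot F)%qT a = \pi_(filter_quot F)%qT b <-> F (a ⇒ b) /\ F (b ⇒ a).
Proof.
by split=> [/eqmodP/filter_equivP|ab]; last exact/eqmodP/filter_equivP.
Qed.

Lemma pi_complements a b :
  complements (\pi_(filter_quot F)%qT a) (\pi_(filter_quot F)%qT b) <->
  F (a `|` b) /\ F ((a `&` b) ⇒ \bot).
Proof.
have up := filter_up (filterP F).
rewrite /complements.
have -> : (\pi_(filter_quot F)%qT a `&` \pi_(filter_quot F)%qT b =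
           \pi_(filter_quot F)%qT (a `&` b)) by rewrite pi_quot_meet.
have -> : (\pi_(filter_quot F)%qT a `|` \pi_(filter_quot F)%qT b =
           \pi_(filter_quot F)%qT (a `|` b)) by rewrite pi_quot_join.
split=> [[/pi_eqP[Fm _] /pi_eqP[_ Fj]]|[Fj Fm]].
  by split=> //; apply: up Fj; rewrite -{1}(odotx1 (_ ⇒ _)); exact: rimp_mp.
split; apply/pi_eqP; split => //; try exact: filter_rimp_le (le0x _).
  by apply: filter_rimp_le; exact: lex1.
by apply: up Fj; rewrite rimpP odotx1.
Qed.

End QuotientComplements.

(** * Decomposing a semilocal algebra *)

Section Semilocal.
Variable A : residuatedLatticeType.
Implicit Types (M N : set A) (e f x y : A).

(** Lifting along the radical separates a maximal filter [M] from the others: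
    the element to be lifted is [y] with [x y = 0], [x] in [M] and [y] in every
    other maximal filter; modulo [Rad A] it is complemented by [x]. *)
Lemma separating_complemented (s : seq (set A)) M :
  @max_spec A = [set` s] -> filter_BLP (Rad A) -> maximal_filter M ->
  exists2 e, complemented e & forall N, maximal_filter N -> N e <-> N <> M.
Proof.
move=> sE lift maxM; have [fM _ _] := maxM.
have maxs N : N \in s <-> maximal_filter N.
  by have -> : maximal_filter N = [set` s] N by rewrite -sE.
have [||x Mx [y sy xy]] :=
    comaximal_bigcap _ M [seq N <- s | N != M] fM.
- by move=> N; rewrite mem_filter => /andP[_ /maxs[]].
- move=> N; rewrite mem_filter => /andP[NM /maxs maxN].
  by apply: maximal_filters_comaximal => // MN; rewrite MN eqxx in NM.
have {}sy N : maximal_filter N -> N <> M -> N y.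
  by move=> maxN NM; apply: sy; rewrite mem_filter; apply/andP; split;
    [exact/eqP|exact/maxs].
have Radj : rad_set (A := A) (x `|` y).
  move=> N maxN; have [fN _ _] := maxN.
  have [->|NM] := pselect (N = M); first by apply: (filter_up fM) Mx; exact: leUl.
  by apply: (filter_up fN) (sy N maxN NM); exact: leUr.
have Radm : rad_set (A := A) ((x `&` y) ⇒ \bot).
  apply: (filter_up (rad_is_filter A)) Radj; rewrite rimpP -xy odot_joinl leUx.
  by rewrite odot_le2 ?leIr // odotC odot_le2 ?leIl.
have [] := lift (\pi_(filter_quot (Rad A))%qT y).
  exists (\pi_(filter_quot (Rad A))%qT x); apply/complements_sym.
  exact/pi_complements.
move=> e eB /pi_eqP[ey ye]; exists e => // N maxN; have [fN _ _] := maxN.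
have Ney : N e <-> N y.
  by split=> Nz; [apply: (filter_up fN (rimp_mp e y))|
    apply: (filter_up fN (rimp_mp y e))]; apply: filter_odot => //;
    [exact: ey|exact: ye].
split=> [/Ney Ny NM|NM]; last by apply/Ney; exact: sy.
apply: (maximal_filter_bot _ _ maxM); rewrite -xy.
by apply: filter_odot => //; rewrite -NM.
Qed.

(** If [f], the complement of [e], lies in exactly one maximal filter [M], then
    [[e)] is local: the trace of [M] is its greatest proper filter. *)
Lemma upset_local e (eB : boolean_center A e) M : maximal_filter M ->
  (forall N, maximal_filter N -> N e <-> N <> M) -> is_local (upset eB).
Proof.
move=> maxM eM; have [fM _ _] := maxM.
have [f ef] := eB.
apply: (@greatest_filter_local _ [set u : upset eB | M (val u)]).
- split.
  + by exists \top; exact: (is_filter_top _ _ fM).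
  + by move=> u v; exact: (filter_odot fM).
  + by move=> u v uv; apply: (filter_up fM); rewrite Order.le_val.
- by move=> /(eM M maxM).
move=> G fG G0 u Gu.
have fpG := preimage_is_filter _ (upset_proj_morphism eB) _ fG.
have [|N maxN GN] := proper_filter_sub_maximal _ _ fpG.
  by rewrite /= (rl_morph0 (upset_proj_morphism eB)).
have Nf : N f.
  apply: GN; rewrite /preimage /=.
  suff -> : upset_proj eB f = \top by exact: is_filter_top.
  by apply: val_inj; rewrite /= joinC ef.2.
have NM : N = M.
  apply: contrapT => /(eM N maxN).
  exact/(maximal_filter_complements _ _ _ _ maxN (complements_sym _ _ ef)).
by rewrite /= -NM; apply: GN; rewrite /preimage /= upset_proj_val.
Qed.

(** The family may be empty here, which covers the one-element algebra. Its meet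
    and the [f i `&` f j], for [f i] a complement of [e i], are complemented
    and lie in no maximal filter, hence are zero. *)
Lemma semilocal_complete_local : is_semilocal A -> filter_BLP (Rad A) ->
  exists (n : nat) (e : 'I_n -> A) (eB : forall i, boolean_center A (e i)),
    [/\ \meet_i e i = \bot, forall i j, i != j -> e i `|` e j = \top &
        forall i, is_local (upset (eB i))].
Proof.
move=> /finite_seqP[s0 s0E] lift.
have {s0 s0E}[s us sE] : exists2 s : seq (set A), uniq s & @max_spec A = [set` s].
  exists (undup s0); first exact: undup_uniq.
  by rewrite s0E; apply/seteqP; split=> M /=; rewrite mem_undup.
have maxs N : N \in s <-> maximal_filter N.
  by have -> : maximal_filter N = [set` s] N by rewrite -sE.
pose M (i : 'I_(size s)) := nth setT s i.
have maxM i : maximal_filter (M i) by apply/maxs; exact: mem_nth.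
have [e eP] := choice (fun i => (exists2P _ _).1
  (separating_complemented s (M i) sE lift (maxM i))).
exists (size s), e, (fun i => (eP i).1); split.
- apply: complemented_notin_maximal.
    by apply: complemented_meets => i; exact: (eP i).1.
  move=> N maxN Ne; have [fN _ _] := maxN.
  have /(nthP setT)[i si NE] : N \in s by exact/maxs.
  have Ni : N (e (Ordinal si)) by apply: (filter_up fN) Ne; exact: meets_inf.
  by move: Ni => /(eP _).2; apply.
- move=> i j ij.
  have [f ef] := (eP i).1; have [g eg] := (eP j).1.
  have fg := complements_meet _ _ _ _ (complements_sym _ _ ef) (complements_sym _ _ eg).
  apply: complements_bot; rewrite -[X in complements X _](_ : f `&` g = \bot) //.
  apply: complemented_notin_maximal; first by exists (e i `|` e j).
  move=> N maxN Nfg; have [fN _ _] := maxN.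
  have Nsep k z : complements (e k) z -> f `&` g <= z -> N = M k.
    move=> ez fgz; apply: contrapT => NM.
    have := ((eP k).2 N maxN).2 NM.
    apply/(maximal_filter_complements _ _ _ _ maxN (complements_sym _ _ ez)).
    exact: (filter_up fN) Nfg.
  have Mij : M i = M j.
    by rewrite -(Nsep _ _ ef (leIl _ _)); exact: Nsep _ _ eg (leIr _ _).
  by move/eqP: Mij; rewrite nth_uniq // val_eqE (negbTE ij).
- by move=> i; apply: upset_local; [exact: maxM|exact: (eP i).2].
Qed.

End Semilocal.

(** * Products of local algebras *)

(** The isomorphism is [a |-> (a \/ e i)_i], with inverse the meet of the
    coordinates. *)
Lemma complete_family_product (A : residuatedLatticeType) (n : nat)
    (e : 'I_n -> A) (eB : forall i, boolean_center A (e i)) :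
  \meet_i e i = \bot -> (forall i j, i != j -> e i `|` e j = \top) ->
  rl_isomorphic A (rl_prod (fun i => upset (eB i))).
Proof.
move=> em ej.
pose h (a : A) : rl_prod (fun i => upset (eB i)) := [ffun i => upset_proj (eB i) a].
have pM i := upset_proj_morphism (eB i).
exists h.
  split=> [a b|a b|a b|a b||]; apply/ffunP => i; rewrite !ffunE.
  - exact: (rl_morphI (pM i)).
  - exact: (rl_morphU (pM i)).
  - exact: (rl_morphM (pM i)).
  - exact: (rl_morph_rimp (pM i)).
  - exact: (rl_morph0 (pM i)).
  - exact: (rl_morph1 (pM i)).
exists (fun y : rl_prod (fun i => upset (eB i)) =>
  \meet_i val (y i : upset (eB i))) => [a|y].
  apply/le_anti/andP; split; last first.
    by apply/meetsP => i _; rewrite ffunE; exact: leUl.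
  (* [c -> a] is above every complement of an [e i], hence joins to [1] with
     each [e i], and so with their meet, which is [0]. *)
  set c := \meet_i _.
  rewrite -(odot1x c) -rimpP -[c ⇒ a]joinx0 -em join_meets_top // => i.
  apply/le_anti; rewrite lex1 /=; have [f ef] := eB i.
  rewrite -ef.2 joinC leU2 // rimpP.
  apply: (@le_trans _ _ (f ⊙ (a `|` e i))).
    apply: odot_le2 => //; rewrite -[_ `|` _]/(val (upset_proj (eB i) a)).
    have -> : upset_proj (eB i) a = h a i by rewrite ffunE.
    exact: meets_inf.
  rewrite odot_joinr (odotC f (e i)) (complements_odot _ _ ef) joinx0.
  exact: odot_ler.
apply/ffunP => i.
rewrite ffunE (big_morph _ (rl_morphI (pM i)) (rl_morph1 (pM i))).
apply/le_anti/andP; split.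
  rewrite -[leRHS]upset_proj_val; exact: meets_inf.
apply/meetsP => j _; have [->|ji] := eqVneq j i; first by rewrite upset_proj_val.
suff -> : upset_proj (eB i) (val (y j)) = \top by exact: lex1.
apply: val_inj; apply/le_anti; rewrite lex1 /= -(ej _ _ ji).
by apply: leU2 => //; exact: upset_valP.
Qed.

Section ProductOfLocal.
Context {A : residuatedLatticeType} {n : nat}.
Context {B : 'I_n -> residuatedLatticeType}.
Variables (h : A -> rl_prod B) (g : rl_prod B -> A).
Hypotheses (hM : rl_morphism h) (hK : cancel h g) (gK : cancel g h).
Hypothesis localB : forall i, is_local (B i).

(** The [i]-th coordinate of [A], seen through the isomorphism [h]. *)
Definition coord (i : 'I_n) (a : A) : B i := h a i.

Lemma coord_morphism i : rl_morphism (coord i).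
Proof.
rewrite /coord; split=> [a b|a b|a b|a b||].
- by rewrite (rl_morphI hM) ffunE.
- by rewrite (rl_morphU hM) ffunE.
- by rewrite (rl_morphM hM) ffunE.
- by rewrite (rl_morph_rimp hM) ffunE.
- by rewrite (rl_morph0 hM) ffunE.
- by rewrite (rl_morph1 hM) ffunE.
Qed.

Lemma coord_surj i (y : B i) : exists a, coord i a = y.
Proof.
exists (g [ffun j => dfwith (fun j => \top : B j) y j]).
by rewrite /coord gK ffunE dfwith_in.
Qed.

(** A filter of a finite product is the product of its coordinate images. *)
Lemma filter_coord (F : set A) c : is_filter F ->
  (forall i, (coord i @` F) (coord i c)) -> F c.
Proof.
move=> fF Fc.
have {Fc}[m Fm mc] : exists2 m : 'I_n -> A,
    (forall i, F (m i)) & forall i, coord i (m i) = coord i c.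
  have [m mP] := choice (fun i => (exists2P _ _).1 (Fc i)).
  by exists m => i; have [] := mP i.
have Fmeet : F (\meet_i m i).
  apply: big_ind => [|a b Fa Fb|i _] //; first exact: is_filter_top.
  apply: (filter_up fF) (filter_odot fF Fa Fb).
  by rewrite lexI odot_lel odot_ler.
apply: (filter_up fF) Fmeet; apply: (rl_morph_le_inj _ hM (can_inj hK)).
apply/prod_leP => i; rewrite -/(coord i c) -mc.
by apply: (rl_morph_le _ (coord_morphism i)); exact: meets_inf.
Qed.

Lemma product_of_local_semilocal : is_semilocal A.
Proof.
apply: (@sub_finite_set _ _
  ((fun i => coord i @^-1` rad_set (A := B i)) @` setT)); last first.
  exact/finite_image/finite_finset.
move=> M maxM; have [fM _ _] := maxM.
have [i MN] : exists i, ~ (coord i @` M) \bot.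
  apply: contrapT => M0; apply: (maximal_filter_bot _ _ maxM).
  apply: filter_coord => // i; rewrite (rl_morph0 (coord_morphism i)).
  by apply: contrapT => Mi; apply: M0; exists i.
have radE := fun K => local_maximal_rad _ K (localB i).
have fcM := image_is_filter _ (coord_morphism i) _ (coord_surj i) fM.
have [K maxK MK] := proper_filter_sub_maximal _ _ fcM MN.
rewrite (radE K maxK) in MK; have fR := rad_is_filter (B i).
have K0 := maximal_filter_bot _ _ maxK; rewrite (radE K maxK) in K0.
exists i => //; have [_ _] := maxM; apply.
- exact: (preimage_is_filter _ (coord_morphism i)).
- apply/filter_properP; first exact: (preimage_is_filter _ (coord_morphism i)).
  by rewrite /preimage /= (rl_morph0 (coord_morphism i)).
- by move=> a Ma; rewrite /preimage /=; apply: MK; exists a.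
Qed.

(** Modulo [F], an element [a] with a complement is [0] or [1] in each
    coordinate; the corresponding 0-1 vector is a complemented lift of it. *)
Lemma product_of_local_BLP : has_BLP A.
Proof.
move=> F f [f']; elim/quotW: f => a; elim/quotW: f' => b.
move=> /(pi_complements F a b)[Fj Fm].
have fF := filterP F.
have fc i := image_is_filter _ (coord_morphism i) _ (coord_surj i) fF.
have cM := coord_morphism.
pose chi (P : 'I_n -> bool) : A := g [ffun i => if P i then \top else \bot].
have chiE P i : coord i (chi P) = if P i then \top else \bot.
  by rewrite /coord gK ffunE.
pose P i := `[< (coord i @` F) (coord i a) >].
have hinj := can_inj hK.
exists (chi P).
  (* [chi P] is complemented by the opposite 0-1 vector. *)
  exists (chi (fun i => ~~ P i)); split; apply: hinj; apply/ffunP => i;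
    rewrite -![h _ i]/(coord i _) ?(rl_morphI (cM i)) ?(rl_morphU (cM i))
      ?(rl_morph0 (cM i)) ?(rl_morph1 (cM i)) !chiE;
    by case: (P i); rewrite /= ?meetx0 ?meet0x ?joinx1 ?join1x.
apply/pi_eqP; split; apply: filter_coord => // i;
  rewrite (rl_morph_rimp (cM i)) chiE /P; case: asboolP => Pi.
- apply: (filter_up (fc i) _ Pi).
  by rewrite rimpP odotx1.
- apply: (filter_up (fc i)) (is_filter_top _ _ (fc i)).
  by rewrite rimpP odot1x le0x.
- apply: (filter_up (fc i)) (is_filter_top _ _ (fc i)).
  by rewrite rimpP odot1x lex1.
(* The remaining case: the coordinate of [a] is outside the image of [F], so
   that of its complement [b] is inside, and [a] is [0] modulo [F] there. *)
have Gm : (coord i @` F) ((coord i a `&` coord i b) ⇒ \bot).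
  exists ((a `&` b) ⇒ \bot) => //.
  by rewrite (rl_morph_rimp (cM i)) (rl_morphI (cM i)) (rl_morph0 (cM i)).
have Gj : (coord i @` F) (coord i a `|` coord i b).
  by exists (a `|` b) => //; exact: (rl_morphU (cM i)).
have [//|Gb] := local_complements_mod _ _ _ _ (localB i) (fc i) Gj Gm.
apply: (filter_up (fc i)) (filter_odot (fc i) Gm Gb).
rewrite rimpP -odotA; apply: le_trans (rimp_mp (coord i a `&` coord i b) _).
by apply: odot_le2 => //; rewrite lexI odot_lel odot_ler.
Qed.

End ProductOfLocal.

(** * The equivalence *)

Theorem proposition6p18 (A : residuatedLatticeType) :
  let semilocal_BLP := is_semilocal A /\ has_BLP A in
  let semilocal_Rad_BLP := is_semilocal A /\ filter_BLP (Rad A) in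
  let complete_local :=
    exists (n : nat) (e : 'I_n -> A) (eB : forall i, boolean_center A (e i)),
      complete_family e /\ (forall i, is_local (upset (eB i))) in
  let product_of_local :=
    exists (n : nat) (B : 'I_n -> residuatedLatticeType),
      (forall i, is_local (B i)) /\ rl_isomorphic A (rl_prod B) in
  ((\bot : A) <> \top ->
     [<-> semilocal_BLP; semilocal_Rad_BLP; complete_local; product_of_local])
  /\ [<-> semilocal_BLP; semilocal_Rad_BLP; product_of_local].
Proof.
move=> P1 P2 P3 P4.
have P12 : P1 -> P2 by move=> [sl blp]; split=> //; exact: blp.
have P24 : P2 -> P4.
  move=> [sl lift].
  have [n [e [eB [em ej el]]]] := semilocal_complete_local _ sl lift.
  exists n, (fun i => upset (eB i)); split=> //.
  exact: complete_family_product.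
have P41 : P4 -> P1.
  move=> [n [B [localB [h hM [g hK gK]]]]]; split.
    exact: (product_of_local_semilocal h g hM hK gK localB).
  exact: (product_of_local_BLP h g hM hK gK localB).
split=> [A01|]; tfae=> //.
  move=> [sl lift].
  have [n [e [eB [em ej el]]]] := semilocal_complete_local _ sl lift.
  exists n, e, eB; split=> //; split=> //.
  (* An empty meet is [\top], so [n = 0] would force [\bot = \top]. *)
  by case: n e {eB ej el} em => // e; rewrite big_ord0 => /esym.
move=> [n [e [eB [[_ em ej] el]]]].
by exists n, (fun i => upset (eB i)); split=> //; exact: complete_family_product.
Qed.
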